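(* Let $S$ be a semilattice-ordered semigroup and let $\mathrm{cl}$ be a closure operator on $S$. Then the space $X = \{A \in \mathcal{P}(S) \mid A^{\mathrm{cl}} = A\}$, endowed with the subspace topology induced by the hull-kernel topology on $\mathcal{P}(S)$, is a spectral space and a retrocompact subset of $\mathcal{P}(S)$ if and only if $\mathrm{cl}$ is algebraic.
   Context: A semilattice-ordered semigroup is a triple $(S,\cdot,\lor)$ with $S$ nonempty, $(S,\cdot)$ a semigroup, $(S,\lor)$ a semilattice (commutative, associative, idempotent), and $x(y\lor z)=xy\lor xz$, $(x\lor y)z=xz\lor yz$ for all $x,y,z\in S$. $\mathcal{P}(S)$ is the power set of $S$ and $\mathcal{P}_{\mathrm{fin}}(A)$ is the set of finite subsets of $A$. A closure operator on $S$ is a map $\mathrm{cl}:\mathcal{P}(S)\to\mathcal{P}(S)$, written $A\mapsto A^{\mathrm{cl}}$, which is extensive ($A\subseteq A^{\mathrm{cl}}$), idempotent ($(A^{\mathrm{cl}})^{\mathrm{cl}}=A^{\mathrm{cl}}$) and order-preserving ($A\subseteq B\Rightarrow A^{\mathrm{cl}}\subseteq B^{\mathrm{cl}}$). It is algebraic if $A^{\mathrm{cl}}=\bigcup\{F^{\mathrm{cl}}\mid F\in\mathcal{P}_{\mathrm{fin}}(A)\}$ for every $A\subseteq S$. The hull-kernel topology on $\mathcal{P}(S)$ is the topology with open subbasis $D(F)=\{A\in\mathcal{P}(S)\mid F\nsubseteq A\}$, $F\in\mathcal{P}_{\mathrm{fin}}(S)$; with it $\mathcal{P}(S)$ is a spectral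 space. A spectral space is a quasi-compact $T_0$ space in which the quasi-compact open subsets are closed under finite intersections and form a basis, and in which every nonempty irreducible closed subset has a unique generic point. A subset $W$ of a spectral space $Y$ is retrocompact in $Y$ if $U\cap W$ is quasi-compact for every quasi-compact open $U\subseteq Y$. *)

(* Defs.v *)
From HB Require Import structures.
From mathcomp Require Import all_boot all_order.
From mathcomp Require Import all_classical topology.

Set Implicit Arguments.
Unset Strict Implicit.
Unset Printing Implicit Defensive.

Local Open Scope classical_set_scope.

HB.mixin Record isSemilatticeOrdered d S
    of Semigroup S & Order.JoinSemilattice d S := {
  slo_nonempty : inhabited S;
  slo_mulUr : right_distributive (@mul S) (@Order.join d S);
  slo_mulUl : left_distributive (@mul S) (@Order.join d S)
}.

#[short(type="sloSemigroupType")]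
HB.structure Definition SLOSemigroup d :=
  { S of Semigroup S & Order.JoinSemilattice d S & isSemilatticeOrdered d S }.

Record closure_operator (S : Type) (cl : set S -> set S) : Prop :=
  ClosureOperator {
    cl_extensive : forall A, A `<=` cl A;
    cl_idempotent : forall A, cl (cl A) = cl A;
    cl_monotone : forall A B, A `<=` B -> cl A `<=` cl B
  }.

Definition algebraic (S : Type) (cl : set S -> set S) : Prop :=
  forall A, cl A = \bigcup_(F in [set F | finite_set F /\ F `<=` A]) cl F.

(* The power set of S, under its own name so that the hull-kernel topology
   does not become the default topology of every type [set S]. *)
Definition hull_kernel (S : Type) : Type := set S.

Definition hkD (S : Type) (F : set S) : set (hull_kernel S) :=
  [set A : set S | ~ (F `<=` A)].

HB.instance Definition _ (S : Type) := Pointed.copy (hull_kernel S) (set S).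

(* [isSubBaseTopological] counts the empty intersection, i.e. the whole space,
   among the finite intersections of subbasic sets; this matters here since
   the point S of P(S) lies in no D(F). *)
HB.instance Definition _ (S : Type) :=
  isSubBaseTopological.Build (hull_kernel S)
    [set F : set S | finite_set F] (@hkD S).

Definition irreducible (T : topologicalType) (Z : set T) : Prop :=
  Z !=set0 /\ forall A B : set T, closed A -> closed B ->
    Z `<=` A `|` B -> Z `<=` A \/ Z `<=` B.

(* [compact] is quasi-compactness: it does not include the Hausdorff axiom. *)
Definition qc_open (T : topologicalType) : set (set T) :=
  [set U | open U /\ compact U].

Record spectral_space (T : topologicalType) : Prop := SpectralSpace {
  spectral_compact : compact [set: T];
  spectral_kolmogorov : kolmogorov_space T;
  spectral_qc_openI : forall U V : set T,
    qc_open U -> qc_open V -> qc_open (U `&` V);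
  spectral_qc_open_basis : basis (@qc_open T);
  spectral_generic : forall Z : set T, closed Z -> irreducible Z ->
    exists! x : T, closure [set x] = Z
}.

Definition retrocompact (T : topologicalType) (W : set T) : Prop :=
  forall U : set T, open U -> compact U -> compact (U `&` W).

Definition closed_sets (S : Type) (cl : set S -> set S) :
    set (hull_kernel S) :=
  [set A : set S | cl A = A].

(* Main.v *)
Require Import Defs.
From HB Require Import structures.
From mathcomp Require Import all_boot all_order.
From mathcomp Require Import all_classical topology.

Local Open Scope classical_set_scope.

(** The proof rests on one observation about the hull-kernel topology: every
ultrafilter [F] on the power set converges to the set of those [x] that belong
to [F]-almost every set, and this limit is included in every other limit of
[F].  A subset of the power set that contains the limits, in this sense, of its
ultrafilters is therefore compact ([ultra_closed_compact]).  Conversely, open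
sets are closed downwards under inclusion, so a compact subset that is
relatively open in such a set again contains these limits
([compact_open_ultra_closed]).  Stability under limits of ultrafilters passes
to intersections, and hence so does compactness for relatively open sets.

If [cl] is algebraic, the set [X] of its closed sets contains the limits of its
ultrafilters: when [y] is in the closure of the limit, it is in the closure of
a finite subset of it, and almost every closed set contains this finite subset,
hence [y].  Retrocompactness follows, and so do the compactness axioms of a
spectral space.  As for sobriety, a closed irreducible set [Z] has the
intersection of its members as generic point: the nonempty relatively open
subsets of [Z] generate a filter, and this filter converges to that
intersection.

For the converse only the compactness of the sets [D({x}) `&` X] is needed.
Suppose that [x] lies in the closure of [A] but in the closure of no finite
subset of [A].  The sets of those [C] in [X] that avoid [x] and contain [G],
for [G] a finite subset of [A], generate a proper filter, and a cluster point
of it is a closed set that contains [A] and avoids [x], which is absurd. *)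

(** * The hull-kernel topology *)

Section HullKernel.
Context {S : choiceType}.
Implicit Types (A B G : set S) (W : set (hull_kernel S)).

Lemma hkD_set1 (x : S) : hkD [set x] = [set A : set S | ~ A x].
Proof.
apply/seteqP; split=> A /= nA; first by move=> Ax; apply: nA => _ ->.
by move/(_ x erefl).
Qed.

Lemma open_hkD G : finite_set G -> open (hkD G).
Proof.
move=> finG; exists [set hkD G]; last by rewrite bigcup_set1.
by move=> _ ->; exact: finI_from1.
Qed.

Lemma open_avoid (x : S) : open ([set A : set S | ~ A x] : set (hull_kernel S)).
Proof. by rewrite -hkD_set1; apply: open_hkD; exact: finite_set1. Qed.

(** The intersection of the [D({x})] for [x] in [G], which is a basic open set
when [G] is finite. *)
Definition miss G : set (hull_kernel S) :=
  [set A : set S | forall x, G x -> ~ A x].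

Lemma filter_finite (T : Type) (F : set_system T) (P : S -> set T) G :
  Filter F -> finite_set G -> (forall x, G x -> F (P x)) ->
  F [set t | forall x, G x -> P x t].
Proof.
move=> FF /finite_fsetP[E ->] FP.
have := @filter_bigI _ _ E P F FF FP; apply: filterS => t Pt x Ex.
exact: Pt.
Qed.

Lemma open_miss G : finite_set G -> open (miss G).
Proof.
move=> finG; rewrite openE => A mA.
apply: (@filter_finite _ (nbhs (A : hull_kernel S)) (fun x => [set B : set S | ~ B x])).
- exact: finG.
- by move=> x Gx; apply: open_nbhs_nbhs; split; [exact: open_avoid|exact: mA].
Qed.

(** Since [D(G)] is the union of the [D({x})] for [x] in [G], the latter already
form a subbasis, and convergence can be tested on them. *)
Lemma cvg_hull_kernel (F : set_system (hull_kernel S)) (A : hull_kernel S) :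
  Filter F -> (forall x, ~ A x -> F [set B : set S | ~ B x]) -> F --> A.
Proof.
move=> FF FA U; rewrite nbhsE => -[O [[D sD <-] [V DV AV]] sOU].
have {}sOU : V `<=` U by move=> B VB; apply: sOU; exists V.
apply: (filterS sOU); have [E sE VE] := sD V DV.
rewrite -VE in AV *; apply: filter_bigI => G EG.
have [x Gx nAx] : exists2 x, G x & ~ A x.
  by apply: contrapT => nG; apply: (AV G EG) => x Gx; apply: contrapT => nAx;
    apply: nG; exists x.
by apply: filterS (FA x nAx) => B nBx sGB; exact: nBx (sGB x Gx).
Qed.

(** The principal filter at [A] converges to every [B] that includes [A], since
[A] avoids what [B] avoids. *)
Lemma open_down (O : set (hull_kernel S)) A B :
  open O -> A `<=` B -> O B -> O A.
Proof.
move=> oO sAB OB; apply/(principal_filterP (A : hull_kernel S)).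
have : principal_filter (A : hull_kernel S) --> (B : hull_kernel S).
  by apply: cvg_hull_kernel => x nBx; apply/principal_filterP => /= /sAB.
by apply; exact: open_nbhs_nbhs.
Qed.

Lemma nbhs_miss (A : hull_kernel S) (U : set (hull_kernel S)) :
  nbhs A U -> exists G, [/\ finite_set G, miss G A & miss G `<=` U].
Proof.
(* The sets [miss G] that contain [A] generate a filter converging to [A]. *)
pose N := filter_from [set G | finite_set G /\ miss G A] miss.
have FN : Filter N.
  apply: filter_from_filter.
    by exists set0; split=> //; exact: finite_set0.
  move=> G H [finG mG] [finH mH]; exists (G `|` H).
    split; first by rewrite finite_setU.
    by move=> x [] ?; [exact: mG|exact: mH].
  by move=> B mB; split=> x ?; apply: mB; [left|right].
have NA : N --> A.
  apply: cvg_hull_kernel => x nAx; exists [set x].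
    by split; [exact: finite_set1|move=> _ ->].
  by move=> B; apply.
by move=> /NA[G [finG mG] sGU]; exists G.
Qed.

(** * Limits of ultrafilters *)

Definition ultralim (F : set_system (hull_kernel S)) : hull_kernel S :=
  [set x | F [set A : set S | A x]].

(** Closedness in the patch (constructible) topology, the compact Hausdorff
topology in which every ultrafilter [F] has [ultralim F] as its only limit. *)
Definition ultra_closed W :=
  forall F, UltraFilter F -> F W -> W (ultralim F).

Lemma cvg_ultralim F : UltraFilter F -> F --> ultralim F.
Proof.
move=> UF; apply: cvg_hull_kernel => x nFx.
by have [/nFx|] := in_ultra_setVsetC [set A : set S | A x] UF.
Qed.

Lemma ultralim_sub F (A : hull_kernel S) :
  ProperFilter F -> F --> A -> ultralim F `<=` A.
Proof.
move=> PF FA x Fx; apply: contrapT => nAx.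
have Fnx : F [set B : set S | ~ B x].
  by apply: FA; apply: open_nbhs_nbhs; split=> //; exact: open_avoid.
by have [B [Bx]] := filter_ex (filterI Fx Fnx).
Qed.

Lemma ultra_closed_compact W : ultra_closed W -> compact W.
Proof.
move=> cW; rewrite compact_ultra => F UF FW; exists (ultralim F).
by split; [exact: cW|exact: cvg_ultralim].
Qed.

Lemma ultra_closedI W1 W2 :
  ultra_closed W1 -> ultra_closed W2 -> ultra_closed (W1 `&` W2).
Proof.
move=> c1 c2 F UF F12.
by split; [apply: c1|apply: c2]; apply: filterS F12 => A [].
Qed.

Lemma ultra_closed_miss G : ultra_closed (miss G).
Proof.
move=> F UF Fm x Gx Fx.
by have [A [mA Ax]] := filter_ex (filterI Fm Fx); exact: mA Ax.
Qed.

(** Compactness gives some limit of an ultrafilter inside [O `&` W]; the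
[ultralim] is included in it, hence still in the open set [O]. *)
Lemma compact_open_ultra_closed (O : set (hull_kernel S)) W :
  ultra_closed W -> open O -> compact (O `&` W) -> ultra_closed (O `&` W).
Proof.
rewrite compact_ultra => cW oO kOW F UF FOW.
have [A [[OA _] FA]] := kOW F UF FOW; split.
  by apply: open_down oO _ OA; exact: ultralim_sub.
by apply: cW; apply: filterS FOW => B [].
Qed.

End HullKernel.

(** * Subspaces *)

Lemma nbhs_set_val (T : topologicalType) (X : set T) (q : set_type X)
    (U : set (set_type X)) :
  nbhs q U -> exists2 V : set T, nbhs (set_val q) V & set_val @^-1` V `<=` U.
Proof.
rewrite !nbhsE => -[_ [[V oV <-] Vq] sVU]; exists V => //.
by exists V.
Qed.

Lemma open_set_val (T : topologicalType) (X V : set T) :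
  open V -> open (set_val @^-1` V : set (set_type X)).
Proof. by move=> oV; exists V. Qed.

Lemma image_preimage_set_val (T : Type) (X V : set T) :
  set_val @` (set_val @^-1` V : set (set_type X)) = V `&` X.
Proof.
apply/seteqP; split=> [_ [q Vq <-]|t [Vt Xt]].
  by split=> //; exact: set_valP.
by exists (exist _ t (mem_set Xt)).
Qed.

Lemma compact_set_val (T : topologicalType) (X : set T)
    (U : set (set_type X)) :
  compact (set_val @` U) <-> compact U.
Proof.
split=> [kU F PF FU|kU]; last first.
  apply: continuous_compact => //; apply: continuous_subspaceT.
  exact: initial_continuous.
have FvU : (set_val @ F) (set_val @` U) by apply: (@filterS _ F _ U) => // q Uq; exists q.
have [_ [[q Uq <-] clq]] := kU (set_val @ F) _ FvU.
exists q; split=> // A B FA /nbhs_set_val[V nV sVB].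
have FvA : (set_val @ F) (set_val @` A) by apply: (@filterS _ F _ A) => // a Aa; exists a.
have [_ [[a Aa <-] Va]] := clq _ _ FvA nV.
by exists a; split=> //; exact: sVB.
Qed.

Section Subspace.
Context {S : choiceType} {X : set (hull_kernel S)}.

Lemma closure_set_type1 (A : set_type X) :
  closure [set A] = [set B : set_type X | set_val A `<=` set_val B].
Proof.
apply/seteqP; split=> B /=.
  move=> clB x Ax; apply: contrapT => nBx.
  have nB : nbhs B (set_val @^-1` [set C : set S | ~ C x] : set (set_type X)).
    by apply: open_nbhs_nbhs; split=> //; apply: open_set_val; exact: open_avoid.
  by have [_ [-> /(_ Ax)]] := clB _ nB.
move=> sAB U /nbhs_set_val[V + sVU]; rewrite nbhsE => -[O [oO OB] sOV].
exists A; split=> //; apply/sVU/sOV.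
exact: open_down oO sAB OB.
Qed.

Lemma kolmogorov_subspace : kolmogorov_space (set_type X).
Proof.
move=> A B nAB; apply: contrapT => nU.
have le (C D : set_type X) :
    (forall U : set (set_type X), nbhs C U -> U D) ->
    set_val D `<=` set_val C.
  move=> CD; suff : closure [set D] C by rewrite closure_set_type1.
  by move=> U /CD UD; exists D.
move/eqP: nAB; apply; apply: val_inj; apply/seteqP; split; apply: le => U nbU;
  apply: contrapT => nUx; apply: nU; exists U; [right|left];
  by split; apply: mem_set.
Qed.

Lemma basic_basis (B : set (set (set_type X))) :
  B `<=` open ->
  (forall G, finite_set G -> B (set_val @^-1` miss G)) -> basis B.
Proof.
move=> sB Bmiss; split=> // A U /nbhs_set_val[V /nbhs_miss[G [finG mG sGV]] sVU].
exists (set_val @^-1` miss G); first by split; [exact: Bmiss|exact: mG].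
by move=> C mC; exact/sVU/sGV.
Qed.

(** Replaces compactness by a condition that visibly passes to
intersections. *)
Lemma qc_open_subspaceP (U : set (set_type X)) : ultra_closed X ->
  qc_open U <-> open U /\ ultra_closed (set_val @` U).
Proof.
move=> cX; split=> -[oU kU]; split=> //.
  have /compact_set_val := kU; case: oU => O oO <-.
  by rewrite image_preimage_set_val; exact: compact_open_ultra_closed.
by apply/compact_set_val; exact: ultra_closed_compact.
Qed.

(** The generic point is the intersection of the members of [Z]: it lies in [Z]
because the nonempty relatively open subsets of [Z] generate a filter that
converges to it. *)
Lemma irreducible_generic (Z : set (set_type X)) :
  X [set x | forall C : set_type X, Z C -> set_val C x] ->
  closed Z -> irreducible Z ->
  exists! A : set_type X, closure [set A] = Z.
Proof.
set I := [set x | _] => XI cZ [[C0 ZC0] irrZ].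
pose c : set_type X := exist _ (I : hull_kernel S) (mem_set XI).
pose F := filter_from [set O : set (set_type X) | open O /\ Z `&` O !=set0]
  (fun O => Z `&` O).
(* Irreducibility says that nonempty relatively open subsets of [Z] meet. *)
have PF : ProperFilter F.
  apply: filter_from_proper => [|O [_ +]]; last by [].
  apply: filter_from_filter.
    by exists setT; split; [exact: openT|exists C0].
  move=> O1 O2 [oO1 [C1 [ZC1 OC1]]] [oO2 [C2 [ZC2 OC2]]].
  exists (O1 `&` O2); last by move=> C [ZC [? ?]].
  split; first exact: openI.
  apply: contrapT => nZ.
  have [|s|s] := irrZ (~` O1) (~` O2) (open_closedC oO1) (open_closedC oO2).
  - move=> C ZC; apply: contrapT => /not_orP[/contrapT OC /contrapT OC'].
    by apply: nZ; exists C.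
  - exact: s ZC1 OC1.
  - exact: s ZC2 OC2.
have Fc : set_val @ F --> (I : hull_kernel S).
  apply: cvg_hull_kernel => x /existsNP[C /not_implyP[ZC nCx]].
  exists (set_val @^-1` [set B : set S | ~ B x]); last by move=> ? [].
  by split; [apply: open_set_val; exact: open_avoid|exists C].
have Zc : Z c.
  apply: cZ => U /nbhs_set_val[V nV sVU].
  have FV : F (set_val @^-1` V) by exact: Fc.
  have FZ : F Z by exists setT; [split; [exact: openT|exists C0]|move=> ? []].
  by have [C [ZC VC]] := filter_ex (filterI FZ FV); exists C; split=> //; exact: sVU.
have clc : closure [set c] = Z.
  apply/seteqP; split; last first.
    by rewrite closure_set_type1 => C ZC x; exact.
  by rewrite (closure_id Z).1 //; apply: closureS => _ ->.
exists c; split=> // c' clc'; apply: val_inj; apply/seteqP; split.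
  have : closure [set c] c' by rewrite clc -clc'; exact: subset_closure.
  by rewrite closure_set_type1.
have : closure [set c'] c by rewrite clc'.
by rewrite closure_set_type1.
Qed.

End Subspace.

(** * Closure operators *)

Section ClosureOperator.
Context {S : choiceType} {cl : set S -> set S}.
Hypothesis hcl : closure_operator cl.

(** A finite subset of the limit is contained in almost every closed set. *)
Lemma algebraic_ultra_closed : algebraic cl -> ultra_closed (closed_sets cl).
Proof.
move=> alg F UF FX; apply/seteqP; split; last exact: (cl_extensive hcl).
move=> y; rewrite alg => -[G [finG sGF] Gy].
have FG : F [set A : set S | G `<=` A].
  exact: (@filter_finite _ _ F (fun x => [set A : set S | A x])).
rewrite /ultralim /=; apply: filterS (filterI FX FG) => A [clA sGA] /=.
by rewrite -clA; exact: (cl_monotone hcl) sGA _ Gy.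
Qed.

Lemma compact_avoid_algebraic :
  (forall x, compact (hkD [set x] `&` closed_sets cl)) -> algebraic cl.
Proof.
move=> kD A; apply/seteqP; split; last first.
  by move=> x [G [_ sGA]]; exact: (cl_monotone hcl).
move=> x clAx; apply: contrapT => nfin.
(* A cluster point of [F] is a closed set containing [A] but not [x]; the member
   of [F] given by [G] is nonempty because it contains [cl G]. *)
pose F := filter_from [set G | finite_set G /\ G `<=` A]
  (fun G => [set C : hull_kernel S | [/\ closed_sets cl C, ~ C x & G `<=` C]]).
have PF : ProperFilter F.
  apply: filter_from_proper => [|G [finG sGA]].
    apply: filter_from_filter.
      by exists set0; split; [exact: finite_set0|exact: sub0set].
    move=> G H [finG sG] [finH sH]; exists (G `|` H).
      by split; [rewrite finite_setU|rewrite subUset].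
    by move=> C [XC nCx]; rewrite subUset => -[].
  exists (cl G); split; first exact: (cl_idempotent hcl).
    by move=> clGx; apply: nfin; exists G.
  exact: (cl_extensive hcl).
have [|C [[nCx XC] cluC]] := kD x F PF.
  exists set0; first by split; [exact: finite_set0|exact: sub0set].
  by move=> C [XC nCx _]; split=> //; rewrite hkD_set1.
rewrite hkD_set1 /= in nCx; apply: nCx.
have sAC : A `<=` C.
  move=> a Aa; apply: contrapT => nCa.
  have [||B [aB]] := cluC [set B : set S | B a] [set B : set S | ~ B a]; last exact.
  - exists [set a]; last by move=> B [_ _]; exact.
    by split; [exact: finite_set1|move=> _ ->].
  - by apply: open_nbhs_nbhs; split=> //; exact: open_avoid.
by rewrite -[C]XC; exact: (cl_monotone hcl) sAC _ clAx.
Qed.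

Lemma closed_sets_bigcap (Z : set (set_type (closed_sets cl))) :
  closed_sets cl
    [set x | forall C : set_type (closed_sets cl), Z C -> set_val C x].
Proof.
apply/seteqP; split; last exact: (cl_extensive hcl).
move=> x clx C ZC; have <- : cl (set_val C) = set_val C by exact: (set_valP C).
by apply: (cl_monotone hcl) clx => y; exact.
Qed.

Lemma algebraic_spectral :
  algebraic cl -> spectral_space (set_type (closed_sets cl)).
Proof.
move=> /algebraic_ultra_closed cX; split.
- apply/compact_set_val/ultra_closed_compact.
  by rewrite -(preimage_setT set_val) image_preimage_set_val setTI.
- exact: kolmogorov_subspace.
- move=> U V /qc_open_subspaceP-/(_ cX)[oU cU] /qc_open_subspaceP-/(_ cX)[oV cV].
  apply/(qc_open_subspaceP _ cX); split; first exact: openI.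
  suff -> : set_val @` (U `&` V) = set_val @` U `&` set_val @` V.
    exact: ultra_closedI.
  apply/seteqP; split; first exact: sub_image_setI.
  by move=> _ [[A UA <-] [B VB /val_inj eAB]]; exists A => //; rewrite -eAB in UA *.
- apply: basic_basis => [U []//|G finG].
  apply/(qc_open_subspaceP _ cX); split.
    by apply: open_set_val; exact: open_miss.
  rewrite image_preimage_set_val.
  by apply: ultra_closedI => //; exact: ultra_closed_miss.
- by move=> Z; apply: irreducible_generic; exact: closed_sets_bigcap.
Qed.

Lemma algebraic_retrocompact : algebraic cl -> retrocompact (closed_sets cl).
Proof.
move=> /algebraic_ultra_closed cX U oU kU.
apply: ultra_closed_compact; apply: ultra_closedI (cX).
by rewrite -(setIT U) in kU *; exact: compact_open_ultra_closed kU.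
Qed.

Lemma retrocompact_algebraic : retrocompact (closed_sets cl) -> algebraic cl.
Proof.
move=> rX; apply: compact_avoid_algebraic => x; apply: rX.
  by apply: open_hkD; exact: finite_set1.
suff -> : hkD [set x] = miss [set x].
  by apply: ultra_closed_compact; exact: ultra_closed_miss.
by rewrite hkD_set1; apply/seteqP; split=> A /= nA; [move=> _ ->|exact: nA].
Qed.

End ClosureOperator.

(* The subspace X is the subtype [set_type (closed_sets cl)], which carries the
   topology induced by the inclusion into the power set. *)
Theorem theorem3p2 (d : Order.disp_t) (S : sloSemigroupType d)
    (cl : set S -> set S) (hcl : closure_operator cl) :
  (spectral_space (set_type (closed_sets cl)) /\
   retrocompact (closed_sets cl)) <->
  algebraic cl.
Proof.
split=> [[_ rX]|alg]; first exact: retrocompact_algebraic.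
by split; [exact: algebraic_spectral|exact: algebraic_retrocompact].
Qed.
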